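(* For any $r\ge 3$, the competitive ratio of the Move-All-Equally algorithm for $r$-uniform Online Min-Sum Set Cover against the dynamic optimum is $\Omega(r\sqrt{n})$; that is, there is an absolute constant $c>0$ such that for every $r\ge 3$ there are arbitrarily large $n$ for which the competitive ratio of Move-All-Equally against the dynamic optimum is at least $c\,r\sqrt{n}$.
   Context: Let $U$ be a set of $n$ elements; a permutation $\pi$ of $U$ gives each element $e$ a position $\pi[e]\in\{1,\dots,n\}$, and $\pi(S)=\min_{e\in S}\pi[e]$. $d_{KT}(\pi,\sigma)$ is the number of pairs of elements ordered differently by $\pi,\sigma$. In $r$-uniform Online Min-Sum Set Cover, from an initial permutation $\pi_0$, request sets $S_1,\dots,S_m$ with $|S_t|=r$ arrive online; on arrival of $S_t$ an algorithm holding $\pi_{t-1}$ pays access cost $\pi_{t-1}(S_t)$ and then moves to $\pi_t$ paying $d_{KT}(\pi_{t-1},\pi_t)$. The dynamic optimum is $\mathrm{OPT}_{dyn}=\min\sum_{t=1}^m\big(\pi^*_t(S_t)+d_{KT}(\pi^*_{t-1},\pi^*_t)\big)$ over all sequences $\pi^*_1,\dots,\pi^*_m$ with $\pi^*_0=\pi_0$. An algorithm is $c$-competitive against the dynamic optimum if its cost is at most $c\cdot\mathrm{OPT}_{dyn}+\alpha$ for all initial permutations and sequences, with $\alpha$ independent of the sequence; the competitive ratio is the infimum of such $c$. Move-All-Equally: given current permutation $\pi$ and request $S$, let $k=\pi(S)$; the new permutation places each $e\in S$ at position $\pi[e]-(k-1)$ and the elements of $U\setminus S$ fill the remaining positions in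 their relative order in $\pi$. *)

(* Defs.v *)
From mathcomp Require Import all_boot all_order all_algebra perm.
Set Implicit Arguments.
Unset Strict Implicit.
Unset Printing Implicit Defensive.
Import Order.TTheory GRing.Theory Num.Theory.

Section OnlineMSSC.
Variable n : nat.
Implicit Types (pi sg : {perm 'I_n}) (S : {set 'I_n}) (e x y : 'I_n).

(* The universe is 'I_n; [pi e : 'I_n] is the position counted from 0, while
   the problem counts positions from 1. *)
Definition pos pi e : nat := (pi e).+1.

(* The default [n] only matters for the empty set, as [pos pi e <= n]. *)
Definition access pi S : nat := \big[minn/n]_(e in S) pos pi e.

(* Each unordered pair ordered differently by [pi] and [sg] is counted once:
   its elements are listed in the order in which [pi] puts them. *)
Definition dKT pi sg : nat :=
  #|[set xy : 'I_n * 'I_n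
      | (pos pi xy.1 < pos pi xy.2) && (pos sg xy.2 < pos sg xy.1)]|.

(* [A pi0 [:: S_1; ...; S_t]] is the permutation pi_t held after serving S_t;
   it depends only on the requests that have already arrived. *)
Definition online_algorithm := {perm 'I_n} -> seq {set 'I_n} -> {perm 'I_n}.

Definition state (A : online_algorithm) pi0 (Ss : seq {set 'I_n}) (t : nat) :=
  if t is 0 then pi0 else A pi0 (take t Ss).

(* The access cost of S_t is paid in pi_(t-1), before the update. *)
Definition alg_cost (A : online_algorithm) pi0 (Ss : seq {set 'I_n}) : nat :=
  \sum_(t < size Ss) (access (state A pi0 Ss t) (nth set0 Ss t)
                      + dKT (state A pi0 Ss t) (state A pi0 Ss t.+1)).

(* In contrast with [alg_cost], the access cost of S_t is paid in the updated
   permutation pi*_t. *)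
Definition dyn_cost pi0 (Ss : seq {set 'I_n}) (ps : seq {perm 'I_n}) : nat :=
  \sum_(t < size Ss) (access (nth pi0 (pi0 :: ps) t.+1) (nth set0 Ss t)
                      + dKT (nth pi0 (pi0 :: ps) t) (nth pi0 (pi0 :: ps) t.+1)).

Definition opt_dyn pi0 (Ss : seq {set 'I_n}) : nat :=
  dyn_cost pi0 Ss
    [arg min_(ps < nseq_tuple (size Ss) pi0) dyn_cost pi0 Ss ps].

Lemma opt_dyn_le pi0 Ss (ps : (size Ss).-tuple {perm 'I_n}) :
  opt_dyn pi0 Ss <= dyn_cost pi0 Ss ps.
Proof. by rewrite /opt_dyn; case: arg_minnP => // qs _; exact. Qed.

Lemma access_le pi S e : e \in S -> access pi S <= pos pi e.
Proof.
move=> eS; rewrite /access; elim: (index_enum _) (mem_index_enum e) => // x s IHs.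
rewrite inE big_cons => /predU1P[<-|/IHs le_s]; first by rewrite eS geq_minl.
by case: ifP => // _; rewrite geq_min le_s orbT.
Qed.

Lemma access_gt0 pi S e : e \in S -> 0 < access pi S.
Proof.
move=> eS; rewrite /access; elim/big_rec: _ => [|x k _ k0].
  exact: leq_ltn_trans (ltn_ord e).
by rewrite leq_min k0.
Qed.

Lemma access_attained pi S e : e \in S ->
  exists2 x, x \in S & access pi S = pos pi x.
Proof.
move=> eS; have [x xS xmin] := @arg_minnP _ e (mem S) (pos pi) eS.
exists x => //; apply/eqP; rewrite eqn_leq access_le //=.
rewrite /access; elim/big_rec: _ => [|y k yS k0]; first exact: ltn_ord.
by rewrite leq_min k0 xmin.
Qed.

Definition mae_shift pi S e : 'I_n := insubd (pi e) (pi e - (access pi S).-1).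

Definition mae_free pi S : seq 'I_n :=
  [seq j <- enum 'I_n | j \notin [set mae_shift pi S e | e in S]].

Definition mae_rank pi S e : nat := #|[set x in ~: S | pi x < pi e]|.

Definition mae_fun pi S e : 'I_n :=
  if e \in S then mae_shift pi S e
  else nth (pi e) (mae_free pi S) (mae_rank pi S e).

Lemma mae_shiftE pi S e :
  mae_shift pi S e = pi e - (access pi S).-1 :> nat.
Proof. by rewrite val_insubd (leq_ltn_trans (leq_subr _ _)). Qed.

Lemma mae_shift_inj pi S : {in S &, injective (mae_shift pi S)}.
Proof.
move=> x y xS yS /(congr1 val); rewrite /= !mae_shiftE => exy.
have le_pi e : e \in S -> (access pi S).-1 <= pi e.
  by move=> eS; rewrite -ltnS prednK ?(access_gt0 _ eS) ?(access_le pi eS).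
apply: (@perm_inj _ pi); apply: val_inj => /=.
by rewrite -(subnK (le_pi x xS)) exy subnK ?le_pi.
Qed.

Lemma size_mae_free pi S : size (mae_free pi S) = #|~: S|.
Proof.
rewrite size_filter -sum1_count big_enum_cond /= sum1_card.
rewrite (eq_card (B := ~: [set mae_shift pi S e | e in S])); last first.
  by move=> j; rewrite !inE.
apply: (@addnI #|S|); rewrite cardsC.
by rewrite -(card_in_imset (@mae_shift_inj pi S)) cardsC.
Qed.

Lemma mae_rank_lt pi S e : e \notin S -> mae_rank pi S e < size (mae_free pi S).
Proof.
move=> eS; rewrite size_mae_free; apply/proper_card/properP; split.
  by apply/subsetP => x; rewrite inE => /andP[].
by exists e; rewrite !inE ?ltnn ?andbF.
Qed.

Lemma mae_rank_mono pi S x y : x \notin S -> y \notin S ->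
  (mae_rank pi S x < mae_rank pi S y) = (pi x < pi y).
Proof.
have lt_rank u v : u \notin S -> pi u < pi v ->
    mae_rank pi S u < mae_rank pi S v.
  move=> uS uv; apply/proper_card/properP; split.
    by apply/subsetP => z; rewrite !inE => /andP[-> /ltn_trans->].
  by exists u; rewrite !inE ?uS ?uv ?ltnn.
move=> xS yS; case: (ltngtP (pi x) (pi y)) => [/lt_rank->//|/lt_rank|xy].
  by move=> /(_ yS)/ltnW; rewrite leqNgt => /negbTE.
by rewrite /mae_rank xy ltnn.
Qed.

Lemma uniq_mae_free pi S : uniq (mae_free pi S).
Proof. by rewrite filter_uniq ?enum_uniq. Qed.

Lemma mae_fun_inj pi S : injective (mae_fun pi S).
Proof.
have mem_free e : e \notin S ->
    nth (pi e) (mae_free pi S) (mae_rank pi S e) \notin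
      [set mae_shift pi S x | x in S].
  by move=> /(mae_rank_lt pi)/(mem_nth (pi e)); rewrite mem_filter => /andP[].
move=> x y; rewrite /mae_fun.
case: ifPn => xS; case: ifPn => yS.
- exact: mae_shift_inj.
- by move=> exy; have := mem_free y yS; rewrite -exy imset_f.
- by move=> exy; have := mem_free x xS; rewrite exy imset_f.
rewrite (set_nth_default (pi y)) ?mae_rank_lt // => /eqP.
rewrite nth_uniq ?uniq_mae_free ?mae_rank_lt // => /eqP rxy.
apply: (@perm_inj _ pi); apply: val_inj; apply/eqP => /=.
have := mae_rank_mono pi xS yS; have := mae_rank_mono pi yS xS.
by rewrite rxy ltnn; case: ltngtP.
Qed.

(* One step of Move-All-Equally; it is characterised by [mae_in] and
   [mae_out]. *)
Definition mae pi S : {perm 'I_n} := perm (@mae_fun_inj pi S).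

Lemma mae_in pi S e : e \in S ->
  pos (mae pi S) e = pos pi e - (access pi S - 1).
Proof.
move=> eS; rewrite /pos permE /mae_fun eS mae_shiftE subn1 subSn //.
by rewrite -ltnS prednK ?(access_gt0 _ eS) ?(access_le pi eS).
Qed.

Lemma mae_out pi S x y : x \notin S -> y \notin S ->
  (pos (mae pi S) x < pos (mae pi S) y) = (pos pi x < pos pi y).
Proof.
have lt_mae u v : u \notin S -> v \notin S -> pi u < pi v ->
    mae pi S u < mae pi S v.
  move=> uS vS uv; rewrite !permE /mae_fun (negbTE uS) (negbTE vS).
  rewrite (set_nth_default (pi v)) ?mae_rank_lt //.
  have srt : sorted ltn (map val (mae_free pi S)).
    apply: (subseq_sorted ltn_trans (s2 := map val (enum 'I_n))).
      by rewrite map_subseq ?filter_subseq.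
    by rewrite val_enum_ord iota_ltn_sorted.
  have := sorted_ltn_nth ltn_trans 0 srt.
  move=> /(_ (mae_rank pi S u) (mae_rank pi S v)).
  rewrite !inE size_map !mae_rank_lt // mae_rank_mono // uv.
  by rewrite !(nth_map (pi v)) ?mae_rank_lt //; apply.
move=> xS yS; rewrite /pos !ltnS.
case: (ltngtP (pi x) (pi y)) => [/lt_mae->//|/lt_mae|/val_inj/perm_inj->].
  by move=> /(_ yS xS)/ltnW; rewrite leqNgt => /negbTE.
by rewrite ltnn.
Qed.

Definition move_all_equally : online_algorithm := fun pi0 Ss => foldl mae pi0 Ss.

End OnlineMSSC.

(* Imported here because its [set0] shadows the one of finset. *)
From mathcomp Require Import all_classical all_reals ereal.

(* The additive term [alpha] may depend on [n], [r] and [A], but neither on the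
   initial permutation nor on the requests. *)
Definition competitive (R : realType) (n r : nat) (A : online_algorithm n)
    (c : R) : Prop :=
  exists alpha : R, forall (pi0 : {perm 'I_n}) (Ss : seq {set 'I_n}),
    (forall S, S \in Ss -> #|S| = r) ->
    ((alg_cost A pi0 Ss)%:R <= c * (opt_dyn pi0 Ss)%:R + alpha)%R.

(* Valued in the extended reals: the ratio is +oo if [A] is not [c]-competitive
   for any [c]. *)
Definition competitive_ratio (R : realType) (n r : nat)
    (A : online_algorithm n) : \bar R :=
  ereal_inf [set c%:E | c in [set c : R | competitive r A c]]%classic.

(* Main.v *)
Require Import Defs.
From mathcomp Require Import all_boot all_order all_algebra perm.
From mathcomp Require Import zify ring lra.
Set Implicit Arguments.
Unset Strict Implicit.
Unset Printing Implicit Defensive.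
Import Order.TTheory GRing.Theory Num.Theory.

(** Two blocks [a] and [b] of [m] elements lie at distance about [m ^ 2] from
    each other, with [b] in front.  A phase consists of [m + 1] requests with a
    common element [a i], each containing the element at position [m] (counted
    from 0) and otherwise only elements behind it, so that Move-All-Equally moves
    [r] elements by [m] places and pays at least [r * m].  The phase brings
    [a i] from the rear to the front; meanwhile the element just behind [b] is
    requested again and again, and each time it jumps over [b], which drifts back
    by about [m] places in total.  After [m] phases the two blocks have exchanged
    their positions, and the adversary starts again with their roles swapped.
    Moving [a i] to the front once per phase costs only [O(m)] amortized, the
    potential being the number of pairs of a block element and an outsider before
    it.  Hence the ratio is of order [r * m ^ 2 / m = r * m], while [n] is of
    order [m ^ 2]. *)

Section MoveAllEqually.
Variable n : nat.
Implicit Types (pi sg : {perm 'I_n}) (S C : {set 'I_n}) (e x y : 'I_n).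
Implicit Types (T : seq nat) (m c k l : nat).
Implicit Types (Ss Us : seq {set 'I_n}) (ps qs : seq {perm 'I_n}).

(** * Requests given by sets of positions, and how Move-All-Equally acts on them *)

Definition at_pos pi T : {set 'I_n} := [set e | (pi e : nat) \in T].

Lemma card_at_pos pi T (P : pred nat) : uniq T -> all (gtn n) T ->
  #|[set e in at_pos pi T | P (pi e)]| = count P T.
Proof.
move=> uT /allP Tn; rewrite -size_filter.
rewrite cardE -(size_map (fun e => pi e : nat)); apply/perm_size/uniq_perm.
- rewrite map_inj_uniq ?enum_uniq // => x y /val_inj; exact: perm_inj.
- exact: filter_uniq.
move=> s; rewrite mem_filter; apply/mapP/andP => [[e]|[Ps sT]].
  by rewrite mem_enum !inE => /andP[eT Pe] ->.
exists ((pi^-1)%g (Ordinal (Tn s sT))); last by rewrite permKV.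
by rewrite mem_enum !inE permKV /= sT.
Qed.

Lemma count_itv T a b : uniq T -> count (fun s => a <= s < b) T <= b - a.
Proof.
move=> uT; rewrite -size_filter -(size_iota a (b - a)).
apply: uniq_leq_size; first exact: filter_uniq.
move=> s; rewrite mem_filter mem_iota => /andP[/andP[? ?] _]; lia.
Qed.

Lemma card_before pi x : #|[set y | pi y < pi x]| = pi x.
Proof.
rewrite -[in RHS](size_iota 0 (pi x)) cardE -(size_map (fun e => pi e : nat)).
apply/perm_size/uniq_perm; rewrite ?iota_uniq //.
  rewrite map_inj_uniq ?enum_uniq // => u v /val_inj; exact: perm_inj.
move=> s; rewrite mem_iota; apply/mapP/idP => [[y]|sx].
  by rewrite mem_enum inE => yx ->; rewrite yx.
have sn : s < n by apply: ltn_trans (ltn_ord (pi x)); lia.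
by exists ((pi^-1)%g (Ordinal sn)); rewrite ?mem_enum ?inE permKV //=; lia.
Qed.

Lemma access_at_pos pi T m : all (gtn n) T -> m \in T -> all (leq m) T ->
  access pi (at_pos pi T) = m.+1.
Proof.
move=> /allP Tn mT /allP Tm.
pose x := (pi^-1)%g (Ordinal (Tn m mT)).
have xE : pi x = m :> nat by rewrite permKV.
have xS : x \in at_pos pi T by rewrite inE xE.
apply/eqP; rewrite eqn_leq -{1}xE access_le //=.
have [y yS ->] := access_attained pi xS.
by rewrite /pos ltnS Tm //; move: yS; rewrite inE.
Qed.

Lemma mae_at_pos pi T m e : all (gtn n) T -> m \in T -> all (leq m) T ->
  (pi e : nat) \in T -> mae pi (at_pos pi T) e = pi e - m :> nat.
Proof.
move=> Tn mT Tm eT; have eS : e \in at_pos pi T by rewrite inE.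
have := mae_in pi eS; rewrite (access_at_pos _ Tn mT Tm) /pos.
move/allP/(_ _ eT): Tm; lia.
Qed.

(* The position [c] of an element outside the request is a fixed point: it is
   pushed back by exactly the requested elements that jump over it. *)
Lemma mae_not_at_pos pi T m x c :
  uniq T -> all (gtn n) T -> m \in T -> all (leq m) T ->
  (pi x : nat) \notin T -> c + m \notin T ->
  c = pi x + count (fun s => pi x < s < c + m) T ->
  mae pi (at_pos pi T) x = c :> nat.
Proof.
move=> uT Tn mT Tm xT cT cE; set S := at_pos pi T; set c' := mae pi S x.
have xS : x \notin S by rewrite inE.
have splitT a b : a <= b -> count (ltn^~ b) T =
    count (ltn^~ a) T + count (fun s => a <= s < b) T.
  move=> ab; elim: (T) => //= s T' ->; lia.
have posx : pi x = count (ltn^~ (pi x)) T + #|[set y in ~: S | pi y < pi x]| :> nat.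
  rewrite -(card_at_pos pi _ uT Tn) -[LHS]card_before -(cardsID S).
  by congr (_ + _); apply: eq_card => y; rewrite !inE // andbC.
have posx' : c' = count (ltn^~ (c' + m)) T + #|[set y in ~: S | pi y < pi x]| :> nat.
  rewrite -(card_at_pos pi _ uT Tn) -[LHS]card_before -(cardsID S).
  congr (_ + _); apply: eq_card => y; rewrite !inE andbC.
    case: (boolP (_ \in T)) => //= yT.
    by rewrite -/c' (mae_at_pos Tn mT Tm yT); move/allP/(_ _ yT): Tm => /=; lia.
  rewrite andbC; case: (boolP (_ \in T)) => //= yT.
  have yS : y \notin S by rewrite inE.
  by have := mae_out pi yS xS; rewrite /pos !ltnS.
(* Otherwise the requested element at [c' + m] would land on [c'], the place of [x]. *)
have c'T : c' + m \notin T.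
  apply/negP => /[dup] cc'T /(allP Tn) /= c'n.
  pose y := (pi^-1)%g (Ordinal c'n).
  have yE : pi y = c' + m :> nat by rewrite permKV.
  have yT : (pi y : nat) \in T by rewrite yE.
  have := mae_at_pos Tn mT Tm yT; rewrite yE addnK => /val_inj/perm_inj yx.
  by rewrite -yx yT in xT.
have noT a b : a \notin T ->
    count (fun s => a <= s < b) T = count (fun s => a < s < b) T.
  move=> aT; apply: eq_in_count => s sT /=; rewrite leq_eqVlt.
  by case: eqP aT => [->|//]; rewrite sT.
have px : pi x < c + m \/ c + m <= pi x by case: (ltnP (pi x) (c + m)); [left|right].
have cE' : c = count (ltn^~ (c + m)) T + #|[set y in ~: S | pi y < pi x]|.
  have xc : pi x <= c + m by lia.
  by rewrite (splitT _ _ xc) noT //; lia.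
(* The fixed point is unique: if [c < c'], the difference [c' - c] would count the requested
   positions strictly between [c + m] and [c' + m], of which there are fewer. The other case is
   symmetric. *)
case: (ltngtP c c') => // cc'.
  have := splitT (c + m) (c' + m); rewrite noT //.
  have := count_itv (c + m).+1 (c' + m) uT; lia.
have := splitT (c' + m) (c + m); rewrite noT //.
have := count_itv (c' + m).+1 (c + m) uT; lia.
Qed.

(** A requested element at position [p] has only [p - m] elements before it afterwards, so at least
    [m] of its [p] former predecessors are now behind it. Pairs are told apart by their rear
    element. *)
Lemma dKT_mae_at_pos pi T m :
  uniq T -> all (gtn n) T -> m \in T -> all (leq m) T ->
  size T * m <= dKT pi (mae pi (at_pos pi T)).
Proof.
move=> uT Tn mT Tm; set S := at_pos pi T; set sg := mae pi S.
rewrite /dKT -sum1dep_card (eq_bigl (fun xy : 'I_n * 'I_n =>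
  (xy.1 \in predT) && ((pi xy.1 < pi xy.2) && (sg xy.2 < sg xy.1)))) //.
rewrite -(pair_big_dep predT (fun x y => (pi x < pi y) && (sg y < sg x))
  (fun _ _ => 1)) /=.
rewrite (exchange_big_dep predT) //=.
rewrite (bigID (mem S)) /=; apply: leq_trans (leq_addr _ _).
have <- : #|S| = size T.
  rewrite -(count_predT T) -(card_at_pos pi _ uT Tn).
  by apply: eq_card => y; rewrite !inE andbT.
rewrite -sum_nat_const; apply: leq_sum => e eS.
rewrite sum1dep_card.
have eT : (pi e : nat) \in T by move: eS; rewrite inE.
have sge : sg e = pi e - m :> nat by apply: mae_at_pos.
have : m <= pi e by apply: (allP Tm).
have : #|[set y | pi y < pi e]| <=
    #|[set y | (pi y < pi e) && (sg e < sg y)]| + #|[set y | sg y < sg e]|.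
  rewrite -cardsUI; apply: leq_trans (leq_addr _ _).
  apply/subset_leq_card/subsetP => y; rewrite !inE => ye; rewrite ye /=.
  case: (ltngtP (sg e) (sg y)) => // /val_inj/perm_inj ey.
  by rewrite ey ltnn in ye.
rewrite !card_before sge => H me.
have Hk k : pi e <= k + (pi e - m) -> m <= k by lia.
exact: Hk H.
Qed.

(** * Both costs by recursion on the requests, additive under concatenation *)

Fixpoint mae_cost pi (Ss : seq {set 'I_n}) : nat :=
  if Ss is Z :: Ss' then
    access pi Z + dKT pi (mae pi Z) + mae_cost (mae pi Z) Ss'
  else 0.

Fixpoint service_cost sg (Ss : seq {set 'I_n}) (ps : seq {perm 'I_n}) : nat :=
  if (Ss, ps) is (Z :: Ss', p :: ps') then
    access p Z + dKT sg p + service_cost p Ss' ps'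
  else 0.

Lemma alg_cost_mae pi Ss : alg_cost (@move_all_equally n) pi Ss = mae_cost pi Ss.
Proof.
have stateE p Us t : state (@move_all_equally n) p Us t = foldl (@mae n) p (take t Us).
  by case: t => //; rewrite take0.
elim: Ss pi => [|S Ss IHs] pi; first by rewrite /alg_cost big_ord0.
rewrite /alg_cost big_ord_recl /= /move_all_equally take0 /= -IHs; congr (_ + _).
by apply: eq_bigr => t _; rewrite !stateE.
Qed.

Lemma dyn_cost_service sg Ss ps : size ps = size Ss ->
  dyn_cost sg Ss ps = service_cost sg Ss ps.
Proof.
elim: Ss sg ps => [|S Ss IHs] sg [|p ps] //=; first by rewrite /dyn_cost big_ord0.
case=> sz; rewrite /dyn_cost big_ord_recl /= -IHs //; congr (_ + _).
apply: eq_bigr => t _.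
have nthE k : k < (size Ss).+1 -> nth sg (p :: ps) k = nth p (p :: ps) k.
  by move=> kSs; apply: set_nth_default; rewrite /= sz.
have tS := ltn_ord t.
by have := nthE t.+1 tS; have := nthE t (ltnW tS) => /= -> ->.
Qed.

Lemma mae_cost_cat pi Ss Us :
  mae_cost pi (Ss ++ Us) = mae_cost pi Ss + mae_cost (foldl (@mae n) pi Ss) Us.
Proof. by elim: Ss pi => //= S Ss IHs pi; rewrite IHs addnA. Qed.

Lemma service_cost_cat sg Ss ps Us qs : size ps = size Ss ->
  service_cost sg (Ss ++ Us) (ps ++ qs) =
    service_cost sg Ss ps + service_cost (last sg ps) Us qs.
Proof.
elim: Ss sg ps => [|S Ss IHs] sg [|p ps] //= [sz]; by rewrite IHs // addnA.
Qed.

(** * The offline potential and the amortized move to the front *)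

Definition outsiders_before C sg : {set 'I_n * 'I_n} :=
  [set xz | [&& xz.1 \in C, xz.2 \notin C & sg xz.2 < sg xz.1]].

Definition potential C sg : nat := #|outsiders_before C sg|.

Lemma dKTxx sg : dKT sg sg = 0.
Proof.
by apply/eqP; rewrite cards_eq0; apply/eqP/setP => xy; rewrite !inE; lia.
Qed.

(** Serving the singleton of [x] moves it to the front. Each element [u] overtaken by [x] either
    lies in [C], or the pair [(x, u)] leaves the potential; no pair enters it. *)
Lemma move_to_front C sg x : x \in C -> exists2 sg',
  pos sg' x = 1 & dKT sg sg' + potential C sg' <= #|C| + potential C sg.
Proof.
move=> xC; set sg' := mae sg [set x]; exists sg'.
  rewrite mae_in ?inE //.
  have [y /set1P -> ->] := access_attained sg (set11 x).
  by rewrite /pos; lia.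
have x0 : sg' x = 0 :> nat.
  have := mae_in sg (set11 x); have [y /set1P -> ->] := access_attained sg (set11 x).
  by rewrite -/sg' /pos; lia.
have sgE y z : y != x -> z != x -> (sg' y < sg' z) = (sg y < sg z).
  by move=> yx zx; have := @mae_out n sg [set x] y z; rewrite !inE /pos !ltnS; apply.
have sub : outsiders_before C sg' \subset outsiders_before C sg.
  apply/subsetP => -[y z]; rewrite !inE /= => /and3P[yC zC zy].
  rewrite yC zC -sgE //; first by apply: contraNneq zC => ->.
  by apply: contraTneq zy => ->; rewrite x0.
pose B := [set (p.2, p.1) | p in outsiders_before C sg :\: outsiders_before C sg'].
have dB : dKT sg sg' <= #|[set (u, x) | u in C] :|: B|.
  apply/subset_leq_card/subsetP => -[u v]; rewrite !inE /pos /= !ltnS => /andP[uv vu].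
  have ux : u != x by apply: contraTneq vu => ->; rewrite x0.
  have vx : v = x.
    by apply/eqP; apply: contraTT vu => vx; rewrite sgE // -leqNgt ltnW.
  rewrite vx in uv vu *.
  have [uC|uC] := boolP (u \in C); first by rewrite imset_f.
  apply/orP; right; apply/imsetP; exists (x, u) => //.
  by rewrite !inE /= xC uC uv x0.
have cB : #|B| <= potential C sg - potential C sg'.
  apply: leq_trans (leq_imset_card _ _) _.
  by rewrite cardsD (setIidPr sub).
have cU : #|[set (u, x) | u in C] :|: B| <= #|C| + #|B|.
  rewrite cardsU; apply: leq_trans (leq_subr _ _) _.
  by rewrite leq_add2r leq_imset_card.
have := subset_leq_card sub; rewrite -/(potential _ _) -/(potential _ _); lia.
Qed.

(* Serving one phase offline: its common element is moved to the front once,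
   after which each request costs 1. *)
Lemma service_phase C sg x Ss : x \in C -> (forall S, S \in Ss -> x \in S) ->
  exists2 ps, size ps = size Ss &
    service_cost sg Ss ps + potential C (last sg ps)
      <= size Ss + #|C| + potential C sg.
Proof.
move=> xC xSs; case: Ss xSs => [|S Ss] xSs; first by exists [::] => //=; lia.
have [sg' x1 le_pot] := move_to_front sg xC.
exists (nseq (size Ss).+1 sg'); first by rewrite size_nseq.
have acc1 U : U \in S :: Ss -> access sg' U <= 1.
  by move=> /xSs/(access_le sg'); rewrite x1.
have rest Us : {subset Us <= S :: Ss} ->
    service_cost sg' Us (nseq (size Us) sg') <= size Us.
  elim: Us => //= U Us IHs sUs; rewrite dKTxx addn0 -add1n leq_add //.
    by apply/acc1/sUs; rewrite inE eqxx.
  by apply: IHs => V VUs; apply: sUs; rewrite inE VUs orbT.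
have last_nseq k : last sg' (nseq k sg') = sg' by elim: k.
have -> : last sg (nseq (size Ss).+1 sg') = sg' by exact: last_nseq.
have -> : service_cost sg (S :: Ss) (nseq (size Ss).+1 sg') =
  access sg' S + dKT sg sg' + service_cost sg' Ss (nseq (size Ss) sg') by [].
have -> : size (S :: Ss) = (size Ss).+1 by [].
have rest_le : service_cost sg' Ss (nseq (size Ss) sg') <= size Ss.
  by apply: rest => V VSs; rewrite inE VSs orbT.
have := acc1 S (mem_head _ _). lia.
Qed.

Lemma mae_stays pi T m x :
  uniq T -> all (gtn n) T -> m \in T -> all (leq m) T -> (pi x : nat) \notin T ->
  (forall s, s \in T -> ~~ (pi x < s <= pi x + m)) ->
  mae pi (at_pos pi T) x = pi x :> nat.
Proof.
move=> uT Tn mT Tm xT clear_x; have cT : pi x + m \notin T.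
  apply: (contraNN _ xT) => xmT; have := clear_x _ xmT.
  by case: (posnP m) xmT => [->|m0 _]; [rewrite addn0 | lia].
apply: (mae_not_at_pos (m := m)) => //.
rewrite (@eq_in_count _ _ pred0) ?count_pred0 ?addn0 // => s /clear_x /=; lia.
Qed.

(** * The requests of one phase and the trajectories of the two blocks *)

Section Phase.
Variables (m t : nat) (a b : nat -> 'I_n).
Let f := m.+1.
(** As [g - f = m.+1 * m], [m.+1] steps of length [m] lead from [g + i] to [f + i]. *)
Let g := f + m + m * m.
(** The padding starts beyond [g + m + m], too far behind the blocks to jump over them. *)
Hypothesis nE : n = g + m + m + t.+3.

(* During phase [i] the element [a i] travels from block [g] to block [f] by
   steps of [m], while the block [b] moves one place to the right per step;
   [bump] accounts for [a i] passing through that block. *)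
Definition phase_pos i j pi : Prop :=
  [/\ forall k, k < i -> pi (a k) = f + k :> nat,
      pi (a i) = g + i - j * m :> nat,
      forall k, i < k < m -> pi (a k) = g + k :> nat
    & forall k, k < m ->
        pi (b k) = bump (pi (a i)) (f + i + i * m + minn j m + k) :> nat].

Lemma phase_step i j pi : i < m -> j <= m -> phase_pos i j pi ->
  exists S, [/\ #|S| = t.+3, a i \in S, t.+3 * m <= dKT pi (mae pi S)
              & phase_pos i j.+1 (mae pi S)].
Proof.
move=> im jm [a_lt a_i a_gt b_at].
have ijm : i * m + m <= m * m by rewrite addnC -mulSn leq_mul2r im orbT.
have jmm : j * m <= m * m by rewrite leq_mul2r jm orbT.
have jSm : j.+1 * m = m + j * m by rewrite mulSn.
have nE' := nE; have fE : f = m.+1 by [].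
have gE : g = m.+1 + m + m * m by [].
set q : nat := pi (a i).
have qE : q = g + i - j * m by [].
(* The element at position [m] fixes the access cost, the one right behind the
   block [b] jumps over it, and the last positions are padding; the last step
   of a phase leaves the block in place. *)
pose T := if j < m then [:: m, q, bump q (f + i + i * m + j + m) & iota (n - t) t]
          else [:: m, q & iota (n - t.+1) t.+1].
have wq : j < m -> bump q (f + i + i * m + j + m) < n - t.
  move=> jm'; rewrite /bump; lia.
have memT s : s \in T ->
    [|| s == m, s == q, (j < m) && (s == bump q (f + i + i * m + j + m))
      | n - t.+1 <= s < n].
  rewrite /T; case: ifP => _; rewrite !inE mem_iota; lia.
have uT : uniq T.
  rewrite /T; case: ifP => [/[dup] jm' /wq|_] /=; rewrite !inE !mem_iota iota_uniq;
    rewrite /bump; lia.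
have Tn : all (gtn n) T.
  apply/allP => s /memT /=; rewrite /bump; lia.
have mT : m \in T by rewrite /T; case: ifP => _; rewrite !inE eqxx.
have qT : q \in T by rewrite /T; case: ifP => _; rewrite !inE eqxx orbT.
have Tm : all (leq m) T.
  apply/allP => s /memT /=; rewrite /bump; lia.
have sT : size T = t.+3.
  by rewrite /T; case: ifP => _ /=; rewrite ?size_iota.
exists (at_pos pi T); split.
- rewrite -sT -(count_predT T) -(card_at_pos pi _ uT Tn).
  by apply: eq_card => y; rewrite !inE andbT.
- by rewrite inE.
- by rewrite -sT dKT_mae_at_pos.
have a_i' : mae pi (at_pos pi T) (a i) = q - m :> nat by rewrite (mae_at_pos (m := m)).
split.
- move=> k ki; rewrite (mae_stays (m := m)) ?a_lt //.
    apply/negP => /memT; rewrite /bump; lia.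
  move=> s /memT; rewrite /bump; lia.
- rewrite a_i' qE; lia.
- move=> k ikm; rewrite (mae_stays (m := m)) ?a_gt //.
    apply/negP => /memT; rewrite /bump; lia.
  move=> s /memT; rewrite /bump; lia.
move=> k km; have bk := b_at k km; rewrite -/q in bk; rewrite a_i'.
have count0 P c : (forall s, n - t.+1 <= s -> ~~ P s) -> n - t.+1 <= c ->
    forall l, count P (iota c l) = 0.
  move=> nP cn l; apply/eqP; rewrite -leqn0 leqNgt -has_count -all_predC.
  by apply/allP => s; rewrite mem_iota => /andP[cs _]; apply: nP; lia.
apply: (mae_not_at_pos (m := m)) => //; rewrite ?bk.
- apply/negP => /memT; rewrite /bump; lia.
- apply/negP => /memT; rewrite /bump; lia.
(* Only [a i] and, while [j < m], the element right behind the block can jump over [b k]. *)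
have [jm'|jm'] := boolP (j < m).
  have countE P : count P T =
      P m + (P q + (P (bump q (f + i + i * m + j + m)) + count P (iota (n - t) t))).
    by rewrite /T jm'.
  rewrite countE count0; try lia; last first.
    move=> s; rewrite /bump; lia.
  rewrite /bump; lia.
have countE P : count P T = P m + (P q + count P (iota (n - t.+1) t.+1)).
  by rewrite /T (negbTE jm').
rewrite countE count0; try lia; last first.
  move=> s; rewrite /bump; lia.
rewrite /bump; lia.
Qed.

Lemma phase_requests i l j pi : i < m -> j + l = m.+1 -> phase_pos i j pi ->
  exists Ss, [/\ size Ss = l, forall S, S \in Ss -> #|S| = t.+3 /\ a i \in S,
                 l * (t.+3 * m) <= mae_cost pi Ss
               & phase_pos i m.+1 (foldl (@mae n) pi Ss)].
Proof.
move=> im; elim: l j pi => [|l IHl] j pi jl pos_pi.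
  by exists [::]; split=> //=; rewrite -jl addn0.
have jm : j <= m by lia.
have [S [cS aS dS /IHl]] := phase_step im jm pos_pi.
case=> [|Ss [sSs cSs dSs posSs]]; first by lia.
exists (S :: Ss); split=> //=; first by rewrite sSs.
  by move=> U; rewrite inE => /predU1P[->|/cSs].
by rewrite mulSn leq_add // (leq_trans dS) // leq_addl.
Qed.

(** A phase shifts the block [b] by [m.+1] places: [m] from the jumps and one because [a i] is now
    in front of it. *)
Lemma phase_pos_next i pi : i.+1 < m -> phase_pos i m.+1 pi -> phase_pos i.+1 0 pi.
Proof.
move=> im [a_lt a_i a_gt b_at].
have fE : f = m.+1 by [].
have gE : g = m.+1 + m + m * m by [].
have ijm : i * m + m + m <= m * m by rewrite -addnA addnn -mul2n -mulnDl leq_mul2r; lia.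
rewrite mulSn in a_i; split.
- move=> k; rewrite ltnS leq_eqVlt => /predU1P[->|/a_lt//]; lia.
- rewrite a_gt; lia.
- by move=> k ik; rewrite a_gt //; lia.
move=> k km; rewrite b_at // a_i a_gt; last by lia.
rewrite mulSn /bump; lia.
Qed.

Lemma phase_pos_last pi : 0 < m -> phase_pos m.-1 m.+1 pi ->
  (forall k, k < m -> pi (a k) = f + k :> nat) /\
  (forall k, k < m -> pi (b k) = g + k :> nat).
Proof.
move=> m0 [a_lt a_i a_gt b_at].
have fE : f = m.+1 by [].
have gE : g = m.+1 + m + m * m by [].
have mm : m.-1 * m + m = m * m by rewrite addnC -mulSn prednK.
rewrite mulSn in a_i; split=> k km; last by rewrite b_at // a_i /bump; lia.
have [|km'] := ltnP k m.-1; first exact: a_lt.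
have -> : k = m.-1 by lia.
lia.
Qed.

(* The bounds are those of [k] phases; the offline permutation [sg] is arbitrary
   because it is inherited from the preceding blocks. *)
Definition costly_block C k pi Ss : Prop :=
  [/\ forall S, S \in Ss -> #|S| = t.+3,
      k * (m.+1 * (t.+3 * m)) <= mae_cost pi Ss
    & forall sg, exists2 ps, size ps = size Ss &
        service_cost sg Ss ps + potential C (last sg ps)
          <= k * (3 * m).+1 + potential C sg].

Lemma costly_block_cat C k l pi Ss Us :
  costly_block C k pi Ss -> costly_block C l (foldl (@mae n) pi Ss) Us ->
  costly_block C (k + l) pi (Ss ++ Us).
Proof.
move=> [cSs aSs oSs] [cUs aUs oUs]; split.
- by move=> S; rewrite mem_cat => /orP[/cSs|/cUs].
- by rewrite mulnDl mae_cost_cat leq_add.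
move=> sg; have [ps sps ops] := oSs sg; have [qs sqs oqs] := oUs (last sg ps).
exists (ps ++ qs); first by rewrite !size_cat sps sqs.
rewrite service_cost_cat // last_cat mulnDl; lia.
Qed.

(** The offline cost [(3 * m).+1] consists of [m.+1] accesses and at most [2 * m] for overtaking
    elements of [C]. *)
Lemma costly_phase C i pi : #|C| <= 2 * m -> a i \in C -> i < m ->
  phase_pos i 0 pi ->
  exists2 Ss, costly_block C 1 pi Ss & phase_pos i m.+1 (foldl (@mae n) pi Ss).
Proof.
move=> cC aC im pos_pi.
have [Ss [sSs cSs dSs posSs]] := phase_requests im (add0n m.+1) pos_pi.
exists Ss => //; split; rewrite ?mul1n //; first by move=> S /cSs[].
move=> sg; have aSs S : S \in Ss -> a i \in S by move=> /cSs[].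
have [ps sps ops] := service_phase sg aC aSs.
by exists ps => //; rewrite sSs in ops; lia.
Qed.

Lemma costly_phases C i l pi : #|C| <= 2 * m -> (forall k, k < m -> a k \in C) ->
  i + l.+1 = m -> phase_pos i 0 pi ->
  exists2 Ss, costly_block C l.+1 pi Ss &
    phase_pos m.-1 m.+1 (foldl (@mae n) pi Ss).
Proof.
move=> cC aC; elim: l i pi => [|l IHl] i pi il pos_pi.
  have -> : m.-1 = i by lia.
  have im : i < m by lia.
  exact: costly_phase (aC i im) im pos_pi.
have im : i < m by lia.
have [Ss bSs posSs] := costly_phase cC (aC i im) im pos_pi.
have [||Us bUs posUs] := IHl i.+1 (foldl (@mae n) pi Ss); first by lia.
  by apply: phase_pos_next; rewrite //; lia.
exists (Ss ++ Us); last by rewrite foldl_cat.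
by rewrite -(add1n l.+1); apply: costly_block_cat bUs.
Qed.

End Phase.

(** * Rounds of [m] phases with alternating roles of the blocks *)

Lemma costly_rounds m t a b C K pi : n = m.+1 + m + m * m + m + m + t.+3 -> 0 < m ->
  #|C| <= 2 * m -> (forall k, k < m -> a k \in C /\ b k \in C) ->
  phase_pos m a b 0 0 pi -> exists Ss, costly_block m t C (K * m) pi Ss.
Proof.
move=> nE m0 cC; elim: K a b pi => [|K IHK] a b pi abC pos_pi.
  by exists [::]; split=> // sg; exists [::].
have aC k : k < m -> a k \in C by move=> /abC[].
have m1 : 0 + m.-1.+1 = m by rewrite add0n prednK.
have [Ss bSs posSs] := costly_phases nE cC aC m1 pos_pi.
have [a_at b_at] := phase_pos_last nE m0 posSs.
have baC k : k < m -> b k \in C /\ a k \in C by move=> /abC[].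
have [|Us bUs] := IHK b a (foldl (@mae n) pi Ss) baC.
  split=> //.
  - by rewrite b_at // subn0 addn0.
  - by move=> k /andP[_ km]; rewrite b_at.
  move=> k km; rewrite a_at // b_at // /bump; lia.
rewrite prednK // in bSs.
by exists (Ss ++ Us); rewrite mulSn; apply: costly_block_cat bUs.
Qed.

Lemma mae_lower_bound m t : n = m.+1 + m + m * m + m + m + t.+3 -> 0 < m ->
  exists pi0, forall K, exists Ss,
    [/\ forall S, S \in Ss -> #|S| = t.+3,
        K * m * (m.+1 * (t.+3 * m)) <= alg_cost (@move_all_equally n) pi0 Ss
      & opt_dyn pi0 Ss <= K * m * (3 * m).+1 + n * n].
Proof.
move=> nE m0; have n0 : 0 < n by lia.
pose elt k : 'I_n := insubd (Ordinal n0) k.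
have eltE k : k < n -> elt k = k :> nat by move=> kn; rewrite val_insubd kn.
pose a k := elt (m.+1 + m + m * m + k); pose b k := elt (m.+1 + k).
pose C := [set a (k : 'I_m) | k : 'I_m] :|: [set b (k : 'I_m) | k : 'I_m].
have cC : #|C| <= 2 * m.
  rewrite mul2n -addnn cardsU; apply: leq_trans (leq_subr _ _) _.
  by rewrite leq_add // (leq_trans (leq_imset_card _ _)) // card_ord.
have abC k : k < m -> a k \in C /\ b k \in C.
  by move=> km; rewrite !inE !(imset_f _ (x := Ordinal km)) ?orbT.
have pos1 : phase_pos m a b 0 0 1%g.
  split=> //; rewrite ?perm1.
  - by rewrite eltE //; lia.
  - by move=> k /andP[_ km]; rewrite perm1 eltE //; lia.
  by move=> k km; rewrite !perm1 !eltE /bump; lia.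
exists 1%g => K; have [Ss [cSs aSs oSs]] := costly_rounds K nE m0 cC abC pos1.
exists Ss; split=> //; first by rewrite alg_cost_mae.
have [ps sps ops] := oSs 1%g.
have sps' : size ps == size Ss by rewrite sps.
have := opt_dyn_le 1%g (Tuple sps'); rewrite /= dyn_cost_service // => le_opt.
(* The initial potential is the only additive loss, and it does not depend on [K]. *)
have : potential C 1%g <= n * n.
  by apply: leq_trans (max_card _) _; rewrite card_prod !card_ord.
lia.
Qed.

End MoveAllEqually.

(* From the cost bounds to the competitive ratio *)
From mathcomp Require Import all_classical all_reals ereal.

Lemma archimedean_contra (R : realType) (x y : R) :
  (forall K : nat, K%:R * x <= y)%R -> (x <= 0)%R.
Proof.
move=> Kxy; rewrite leNgt; apply/negP => x0.
have := archi_boundP (divr_ge0 (normr_ge0 y) (ltW x0)).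
rewrite ltr_pdivrMr // => /lt_le_trans/(_ (Kxy _)).
by rewrite ltNge ler_norm.
Qed.

Lemma competitive_ge (R : realType) (m t n : nat) (c : R) :
  n = m.+1 + m + m * m + m + m + t.+3 -> 0 < m ->
  competitive t.+3 (@move_all_equally n) c -> (t.+3%:R * m%:R / 3 <= c)%R.
Proof.
move=> nE m0 [alpha c_comp].
have [pi0 hard] := mae_lower_bound nE m0.
(* A nonnegative factor is needed to insert the upper bound on the optimum. *)
suff : (t.+3%:R * m%:R / 3 <= Num.max c 0)%R.
  have tm : (0 < t.+3%:R * m%:R / 3 :> R)%R by rewrite divr_gt0 ?mulr_gt0 ?ltr0n.
  by rewrite le_max => /orP[//|]; rewrite leNgt tm.
set d := Num.max c 0%R.
have d0 : (0 <= d)%R by rewrite le_max lexx orbT.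
have bound K : (K%:R * (m%:R * (m.+1%:R * (t.+3%:R * m%:R) - d * (3 * m%:R + 1)))
    <= d * (n%:R * n%:R) + alpha)%R.
  have [Ss [cSs aSs oSs]] := hard K.
  have := c_comp pi0 Ss cSs.
  have : (c * (opt_dyn pi0 Ss)%:R <= d * (K * m * (3 * m).+1 + n * n)%:R)%R.
    apply: (@le_trans _ _ (d * (opt_dyn pi0 Ss)%:R)%R).
      by rewrite ler_wpM2r // le_max lexx.
    by rewrite ler_wpM2l // ler_nat.
  have : ((K * m * (m.+1 * (t.+3 * m)))%:R <=
          (alg_cost (@move_all_equally n) pi0 Ss)%:R :> R)%R by rewrite ler_nat.
  rewrite -(addn1 (3 * m)) !(natrM, natrD).
  set u := (_%:R)%R; set v := (_%:R)%R.
  lra.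
(* Letting [K] grow removes [alpha] and the initial potential. *)
have := archimedean_contra bound.
have mR : (0 < m%:R :> R)%R by rewrite ltr0n.
rewrite pmulr_rle0 // -(addn1 m) natrD.
set T := (t.+3%:R)%R; have T0 : (0 < T :> R)%R by rewrite ltr0n.
rewrite ler_pdivrMr //.
(* This uses [3 * (m + 1) >= 3 * m + 1]. *)
nra.
Qed.

Theorem theorem5 (R : realType) :
  exists c : R, (0 < c)%R /\
    forall r : nat, 3 <= r ->
    forall N : nat, exists n : nat, N <= n /\ r <= n /\
      ((c * r%:R * Num.sqrt n%:R)%:E
         <= competitive_ratio R r (@move_all_equally n))%E.
Proof.
(* One factor 3 comes from the ratio [r * m / 3], the other from [n <= (3 * m) ^ 2], which holds
   because [m] is chosen at least [r]. *)
exists (9^-1)%R; split; first by rewrite invr_gt0.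
move=> r r3 N; pose m := N + r.
have m0 : 0 < m by rewrite /m; lia.
have rE : r = (r - 3).+3 by lia.
exists (m.+1 + m + m * m + m + m + r); split; first by rewrite /m; lia.
split; first by lia.
set n := (_ + r)%N.
apply/ereal_infP => _ [c c_comp <-]; rewrite lee_fin.
have nE : n = m.+1 + m + m * m + m + m + (r - 3).+3 by rewrite -rE.
have := @competitive_ge R m (r - 3) n c nE m0; rewrite -rE => /(_ c_comp).
apply: le_trans.
have sqrt_n : (Num.sqrt n%:R <= 3 * m%:R :> R)%R.
  rewrite -[leRHS]ger0_norm ?mulr_ge0 // -sqrtr_sqr.
  rewrite ler_wsqrtr // exprMn -!natrX -natrM ler_nat.
  have rm : r <= m by rewrite /m leq_addl.
  have mm : m <= m * m by rewrite leq_pmull.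
  rewrite -mulnn -mulnn /n; lia.
have -> : (r%:R * m%:R / 3 = 9^-1 * r%:R * (3 * m%:R) :> R)%R by field.
by rewrite ler_wpM2l // mulr_ge0 ?invr_ge0.
Qed.
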